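(* Let $\mathbf{k}$ be a field and $\lambda\in\mathbf{k}$. The modified Rota-Baxter operated polynomial identity of weight $\lambda$, $$\phi(x_1,x_2)=\lfloor x_1\rfloor\lfloor x_2\rfloor-\lfloor x_1\lfloor x_2\rfloor\rfloor-\lfloor\lfloor x_1\rfloor x_2\rfloor-\lambda x_1x_2,$$ is Gröbner-Shirshov: for each set $Z$ there is a monomial order $\leq$ on $\mathfrak{M}(Z)$ such that $S_\phi(Z)=\{\phi(u_1,u_2)\mid u_1,u_2\in\mathfrak{M}(Z)\}$ is a Gröbner-Shirshov basis in $\mathbf{k}\mathfrak{M}(Z)$ with respect to $\leq$.
   Context: **Bracketed words.** For a set $Z$, $M(Z)$ denotes the free monoid on $Z$. Put $\mathfrak{M}_0(Z)=M(Z)$ and $\mathfrak{M}_n(Z)=M(Z\cup\lfloor \mathfrak{M}_{n-1}(Z)\rfloor)$ for $n\ge1$, where $\lfloor Y\rfloor=\{\lfloor u\rfloor\mid u\in Y\}$ is a disjoint copy of $Y$; with the natural embeddings, $\mathfrak{M}(Z)=\bigcup_n\mathfrak{M}_n(Z)$. Elements are called bracketed words (or monomials); $\mathfrak{M}(Z)$ is the free monoid with a self-map $u\mapsto\lfloor u\rfloor$ on $Z$, and $\mathbf{k}\mathfrak{M}(Z)$ (the $\mathbf{k}$-span, with $\lfloor\ \rfloor$ extended linearly) is the free operated algebra on $Z$ (an associative unitary $\mathbf{k}$-algebra with a $\mathbf{k}$-linear self-map). Every $1\ne u\in\mathfrak{M}(Z)$ is uniquely a product $u_1\cdots u_n$ with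 $n\ge1$ and $u_i\in Z\cup\lfloor\mathfrak{M}(Z)\rfloor$; $|u|:=n$ is its breadth, and $|1|:=0$. $\mathfrak{M}^\star(Z)$ is the set of bracketed words on $Z\cup\{\star\}$ ($\star\notin Z$) containing $\star$ exactly once; for $q\in\mathfrak{M}^\star(Z)$, $q|_u$ is obtained by replacing $\star$ by $u\in\mathfrak{M}(Z)$, and $q|_s=\sum_i c_i q|_{u_i}$ for $s=\sum_i c_iu_i\in\mathbf{k}\mathfrak{M}(Z)$. $\phi(u_1,u_2)$ is obtained from $\phi$ by substituting $u_i$ for $x_i$. **Gröbner-Shirshov bases.** A monomial order on $\mathfrak{M}(Z)$ is a well-order $\leq$ such that $u<v$ implies $q|_u<q|_v$ for all $u,v\in\mathfrak{M}(Z)$, $q\in\mathfrak{M}^\star(Z)$. The leading monomial $\overline f$ of $f\ne0$ is its largest monomial; $f$ is monic if the coefficient of $\overline f$ is $1$. For monic $f,g\in\mathbf{k}\mathfrak{M}(Z)$: if $w=\overline f u=v\overline g$ with $w,u,v\in\mathfrak{M}(Z)$ and $\max\{|\overline f|,|\overline g|\}<|w|<|\overline f|+|\overline g|$, then $fu-vg$ is an intersection composition with respect to $w$; if $w=\overline f=q|_{\overline g}$ with $q\in\mathfrak{M}^\star(Z)$, then $f-q|_g$ is an including composition with respect to $w$. An element is trivial modulo $(S,w)$ if it equals a finite sum $\sum_ic_iq_i|_{s_i}$ with $c_i\in\mathbf{k}$, $q_i\in\mathfrak{M}^\star(Z)$, $s_i\in S$, $q_i|_{\overline{s_i}}<w$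 ($0$ is always trivial). $S$ is a Gröbner-Shirshov basis with respect to $\leq$ if, after making its elements monic, all intersection and including compositions of pairs $f,g\in S$ with respect to any $w$ are trivial modulo $(S,w)$. *)

(* Defs.v *)
From HB Require Import structures.
From mathcomp Require Import all_boot all_order all_algebra.
From mathcomp Require Import finmap.
From mathcomp Require Import monalg.
From mathcomp Require Import boolp classical_sets.
From mathcomp Require wochoice.

Set Implicit Arguments.
Unset Strict Implicit.
Unset Printing Implicit Defensive.

Import GRing.Theory.
Local Open Scope ring_scope.

(* Bracketed words: a word is a finite sequence of letters, and a letter is   *)
(* either an element of Z or a bracketed word in brackets.  The stage M_n(Z)  *)
(* of the usual construction consists of the words of bracket depth at most   *)
(* n, so this inductive type is their union.  The empty word is 1, the        *)
(* product is concatenation and the breadth is the size of the sequence.      *)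
Inductive letter (Z : Type) : Type :=
  | Gen of Z
  | Br of seq (letter Z).

Definition word (Z : Type) : Type := seq (letter Z).

HB.instance Definition _ (Z : Type) := gen_eqMixin (letter Z).
HB.instance Definition _ (Z : Type) := gen_choiceMixin (letter Z).
HB.instance Definition _ (Z : Type) := Choice.copy (word Z) (seq (letter Z)).

Lemma word_unit (Z : Type) (u v : word Z) : u ++ v = [::] -> u = [::] /\ v = [::].
Proof. by case: u => //= ->. Qed.

HB.instance Definition _ (Z : Type) :=
  Choice_isMonomialDef.Build (word Z)
    (@catA (letter Z)) (@cat0s (letter Z)) (@cats0 (letter Z)) (@word_unit Z).

Definition gen (Z : Type) (z : Z) : word Z := [:: Gen z].
Definition br (Z : Type) (u : word Z) : word Z := [:: Br u].
Definition breadth (Z : Type) (u : word Z) : nat := size u.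

(* wbind f is the morphism of operated monoids from the words on Y to the     *)
(* words on Z that extends f : Y -> word Z.                                   *)
Fixpoint lbind (Y Z : Type) (f : Y -> word Z) (a : letter Y) : word Z :=
  match a with
  | Gen y => f y
  | Br u => [:: Br (flatten (map (lbind f) u))]
  end.

Definition wbind (Y Z : Type) (f : Y -> word Z) (u : word Y) : word Z :=
  flatten (map (lbind f) u).

(* The star is None in option Z. *)
Fixpoint lstars (Z : Type) (a : letter (option Z)) : nat :=
  match a with
  | Gen None => 1
  | Gen (Some _) => 0
  | Br u => sumn (map (@lstars Z) u)
  end.

Definition stars (Z : Type) (q : word (option Z)) : nat :=
  sumn (map (@lstars Z) q).

Definition starword (Z : Type) : Type := {q : word (option Z) | stars q == 1%N}.

Definition plug (Z : Type) (q : starword Z) (u : word Z) : word Z :=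
  wbind (fun o : option Z => if o is Some z then gen z else u) (sval q).

Definition linext (k : fieldType) (Y Z : Type) (f : word Y -> word Z)
    (p : {malg k[word Y]}) : {malg k[word Z]} :=
  \sum_(w <- msupp p) p@_w *: << f w >>.

Definition bracket (k : fieldType) (Z : Type) (p : {malg k[word Z]}) :
  {malg k[word Z]} := linext (@br Z) p.

Definition mplug (k : fieldType) (Z : Type) (q : starword Z)
  (s : {malg k[word Z]}) : {malg k[word Z]} := linext (plug q) s.

(* phi(u_1, ..., u_n), for phi an operated polynomial in n variables. *)
Definition opsubst (k : fieldType) (n : nat) (Z : Type)
    (phi : {malg k[word 'I_n]}) (u : 'I_n -> word Z) : {malg k[word Z]} :=
  linext (wbind u) phi.

Definition opi_set (k : fieldType) (n : nat) (phi : {malg k[word 'I_n]})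
    (Z : Type) : set {malg k[word Z]} :=
  range (fun u : 'I_n -> word Z => opsubst phi u).

Section GroebnerShirshov.
Variables (k : fieldType) (Z : Type) (le : rel (word Z)).

Definition wlt (u v : word Z) : bool := (u != v) && le u v.

Definition monomial_order : Prop :=
  wochoice.well_order le /\
  forall (u v : word Z) (q : starword Z), wlt u v -> wlt (plug q u) (plug q v).

(* The largest monomial of p when le is a total order and p != 0;             *)
(* the value at p = 0 is irrelevant.                                          *)
Definition lead (p : {malg k[word Z]}) : word Z :=
  last ([::] : word Z) (sort le (msupp p)).

Definition make_monic (p : {malg k[word Z]}) : {malg k[word Z]} :=
  (p@_(lead p))^-1 *: p.

Definition monic_set (S : set {malg k[word Z]}) : set {malg k[word Z]} :=
  [set make_monic s | s in [set s | S s /\ s != 0]].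

Definition intersection_composition (f g : {malg k[word Z]}) (w : word Z)
    (h : {malg k[word Z]}) : Prop :=
  exists u v : word Z,
    [/\ w = lead f ++ u, w = v ++ lead g,
        (maxn (breadth (lead f)) (breadth (lead g)) < breadth w)%N,
        (breadth w < breadth (lead f) + breadth (lead g))%N
      & h = f * << u >> - << v >> * g].

Definition including_composition (f g : {malg k[word Z]}) (w : word Z)
    (h : {malg k[word Z]}) : Prop :=
  exists q : starword Z,
    [/\ w = lead f, w = plug q (lead g) & h = f - mplug q g].

Definition trivial_mod (S : set {malg k[word Z]}) (w : word Z)
    (h : {malg k[word Z]}) : Prop :=
  exists (n : nat) (c : 'I_n -> k) (q : 'I_n -> starword Z)
         (s : 'I_n -> {malg k[word Z]}),
    (forall i, S (s i) /\ wlt (plug (q i) (lead (s i))) w) /\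
    h = \sum_(i < n) c i *: mplug (q i) (s i).

Definition GS_basis (S : set {malg k[word Z]}) : Prop :=
  forall (f g : {malg k[word Z]}) (w : word Z) (h : {malg k[word Z]}),
    monic_set S f -> monic_set S g ->
    intersection_composition f g w h \/ including_composition f g w h ->
    trivial_mod (monic_set S) w h.

End GroebnerShirshov.

(* An operated polynomial identity is Groebner-Shirshov if its set of         *)
(* substitution instances over every Z is a Groebner-Shirshov basis for some  *)
(* monomial order.                                                            *)
Definition GS_opi (k : fieldType) (n : nat) (phi : {malg k[word 'I_n]}) : Prop :=
  forall Z : Type, exists le : rel (word Z),
    monomial_order le /\ GS_basis le (@opi_set k n phi Z).

Definition modified_Rota_Baxter (k : fieldType) (lambda : k) :
    {malg k[word 'I_2]} :=
  let x1 : {malg k[word 'I_2]} := << gen ord0 >> in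
  let x2 : {malg k[word 'I_2]} := << gen ord_max >> in
  bracket x1 * bracket x2 - bracket (x1 * bracket x2)
    - bracket (bracket x1 * x2) - lambda *: (x1 * x2).

(* Main.v *)
From HB Require Import structures.
From mathcomp Require Import all_boot all_order all_algebra.
From mathcomp Require Import finmap.
From mathcomp Require Import monalg.
From mathcomp Require Import boolp classical_sets.
From mathcomp Require wochoice.
From mathcomp Require Import ring zify.
Require Import Defs.
From mathcomp Require Import ssralg.

(* Order the bracketed words by total degree (letters plus brackets), then by  *)
(* breadth, then lexicographically along the word written in prefix form.      *)
(* For this order the leading monomial of phi(u,v) is [u][v]: [u[v]] and       *)
(* [[u]v] have the same degree but smaller breadth, and uv has smaller degree. *)
(* Leading monomials overlap only in [u][v][w], or when one of them occurs     *)
(* inside u or v in [u][v].  The first composition reduces to 0 through six    *)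
(* instances of phi.  In the second one, [F([a][b])][v] is reduced either by   *)
(* phi(F([a][b]),v) or by phi(a,b), and the difference consists of the         *)
(* phi(F(m),v), for m a lower monomial of phi(a,b), and of phi(a,b) plugged    *)
(* into the lower monomials of phi(F(-),v).                                    *)

Set Implicit Arguments.
Unset Strict Implicit.
Unset Printing Implicit Defensive.

Import GRing.Theory.
Local Open Scope ring_scope.

(** Compatibility of the order with contexts ([wordle_monomial_order]) and the leading monomial
    [u][v] of phi(u,v) ([lead_mrb]) give one tool, [trivial_mrb]: an instance of phi placed in a
    context is trivial modulo w once its leading monomial there is below w. So each composition only
    needs an explicit identity expressing it by such instances. For [u][v][w] this is
    [trivial_intersection]. When [a][b] occurs inside a bracket, it comes from expanding
    phi(F(phi(a,b)),v), or its mirror image, in two ways ([trivial_including_l],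
    [trivial_including_r]). Both identities hold for every lambda. Counting letters in
    [mrb_GS_basis] leaves only these overlaps and the inclusion of an instance in itself. *)

(** * Well-orders *)

Section WellOrder.
Variables (T : Type) (R : rel T).
Hypothesis Rwo : wochoice.well_order R.

Let wo_chainT : wochoice.wo_chain (R : rel {classic T}) predT.
Proof. by move=> A _; apply: Rwo. Qed.

Lemma well_order_total : total R.
Proof. by move=> x y; apply: (wochoice.wo_chainW wo_chainT). Qed.

Lemma well_order_refl : reflexive R.
Proof. by move=> x; rewrite -[R x x]orbb well_order_total. Qed.

Lemma well_order_anti : antisymmetric R.
Proof. by move=> x y; apply: (wochoice.wo_chain_antisymmetric wo_chainT). Qed.

Lemma well_order_min (P : T -> Prop) :
  (exists x, P x) -> exists2 x, P x & forall y, P y -> R x y.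
Proof.
move=> [x Px]; have [|z [[zP zmin] _]] := Rwo (A := fun x => `[< P x >]).
  by exists x; apply/asboolP.
by exists z; [apply/asboolP | move=> y Py; apply: zmin; apply/asboolP].
Qed.

(** The minimum of the three points, compared by antisymmetry with its neighbour, gives the
    result. *)
Lemma well_order_trans : transitive R.
Proof.
move=> y x z Rxy Ryz.
have [t tP tmin] : exists2 t, [\/ t = x, t = y | t = z] &
    forall s, [\/ s = x, s = y | s = z] -> R t s.
  by apply: well_order_min; exists x; constructor 1.
case: tP tmin => -> tmin; first by apply: tmin; constructor 3.
  suff -> : x = y by [].
  by apply: well_order_anti; rewrite Rxy tmin //; constructor 1.
suff -> : z = y by [].
by apply: well_order_anti; rewrite Ryz tmin //; constructor 2.
Qed.

Lemma well_order_relpre (T' : Type) (f : T' -> T) :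
  injective f -> wochoice.well_order (relpre f R).
Proof.
move=> f_inj; apply: wochoice.antisymmetric_well_order.
  by move=> x y /well_order_anti /f_inj.
move=> A [x xA].
have [|y [z zA <-] ymin] := @well_order_min (fun y => exists2 x, x \in A & f x = y).
  by exists (f x), x.
by exists z; split=> // t tA; apply: ymin; exists t.
Qed.

End WellOrder.

Lemma well_order_sum (T : Type) (R : rel T) : wochoice.well_order R ->
  wochoice.well_order (fun a b : nat + T => match a, b with
    | inl m, inl n => (m <= n)%N | inl _, inr _ => true
    | inr _, inl _ => false | inr x, inr y => R x y end).
Proof.
move=> Rwo; apply: wochoice.antisymmetric_well_order.
  move=> [m|x] [n|y] //=; first by rewrite -eqn_leq => /eqP ->.
  by move/(well_order_anti Rwo) ->.
move=> A [a aA].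
have [[n nA]|noN] := pselect (exists n, inl n \in A).
  have [m mA mmin] := ex_minnP (ex_intro (fun n => inl n \in A) n nA).
  by exists (inl m); split=> // -[p /mmin|].
have [|x xA xmin] := well_order_min Rwo (P := fun x => inr x \in A).
  by case: a aA => [n nA|x xA]; [case: noN; exists n | exists x].
by exists (inr x); split=> // -[n nA|y /xmin //]; case: noN; exists n.
Qed.

(** * The shortlex order on sequences *)

Section Shortlex.
Variables (A : Type) (R : rel A).

(** For antisymmetric [R], having both [R a b] and [R b a] means [a = b]; only then are the tails
    compared. *)
Fixpoint lexle (s t : seq A) : bool :=
  match s, t with
  | [::], _ => true
  | _ :: _, [::] => false
  | a :: s', b :: t' => R a b && (R b a ==> lexle s' t')
  end.

Definition shortlex (s t : seq A) : bool :=
  (size s < size t)%N || ((size s == size t) && lexle s t).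

Hypothesis Rwo : wochoice.well_order R.

Lemma lexle_catl (p s t : seq A) : lexle (p ++ s) (p ++ t) = lexle s t.
Proof. by elim: p => //= a p ->; rewrite (well_order_refl Rwo). Qed.

Lemma lexle_catr (r s t : seq A) :
  size s = size t -> lexle s t -> lexle (s ++ r) (t ++ r).
Proof.
elim: s t => [|a s IH] [|b t] //=.
  by move=> _ _; elim: r => //= c r ->; rewrite (well_order_refl Rwo) implybT.
case=> /IH{}IH /andP[-> /= /implyP st].
by apply/implyP=> /st /IH.
Qed.

Lemma lexle_anti : antisymmetric lexle.
Proof.
elim=> [|a s IH] [|b t] //= /andP[/andP[ab st] /andP[ba ts]].
rewrite (well_order_anti Rwo (x := a) (y := b)) ?ab ?ba //.
by rewrite (IH t) // (implyP st ba) (implyP ts ab).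
Qed.

(** The length is fixed because the lexicographic order on all sequences is in general not
    well-founded. The minimum is the least possible head followed by the least tail behind it. *)
Lemma lexle_min (n : nat) (P : seq A -> Prop) :
  (exists2 s, P s & size s = n) ->
  exists s, [/\ P s, size s = n & forall t, P t -> size t = n -> lexle s t].
Proof.
elim: n P => [|n IH] P [s Ps szs].
  by exists [::]; split=> //; case: s Ps szs.
have [|a [u Pu szu] amin] :=
    well_order_min Rwo (P := fun a => exists2 s, P (a :: s) & size s = n).
  by case: s Ps szs => // a s Ps [szs]; exists a, s.
have [|v [Pv szv vmin]] := IH (fun s => P (a :: s)); first by exists u.
exists (a :: v); split=> //=; first by rewrite szv.
move=> [|b t] //= Pt [szt]; rewrite amin ?implybE /=; last by exists t.
have [ba|//] := boolP (R b a); apply: vmin => //.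
by rewrite (well_order_anti Rwo (x := a) (y := b)) // ba amin //; exists t.
Qed.

Lemma shortlex_well_order : wochoice.well_order shortlex.
Proof.
apply: wochoice.antisymmetric_well_order.
  move=> s t /andP[]; rewrite /shortlex.
  case: ltngtP => //= _ st ts.
  by apply: lexle_anti; rewrite st.
move=> B [s0 s0B].
have exn : exists n, `[< exists2 s, s \in B & size s = n >].
  by exists (size s0); apply/asboolP; exists s0.
have [n /asboolP /lexle_min[s [sB szs smin]] nmin] := ex_minnP exn.
exists s; split=> // t tB; rewrite /shortlex szs.
have := nmin (size t); rewrite leq_eqVlt => le_n.
have /orP[/eqP eqn|->//] : (n == size t) || (n < size t)%N.
  by apply: le_n; apply/asboolP; exists t.
by rewrite eqn eqxx ltnn /= smin.
Qed.

End Shortlex.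

(** * Coding bracketed words by sequences *)

Section WordCode.
Variable Z : Type.
Implicit Types (u v w x y : word Z).

Lemma word_ind (P : word Z -> Prop) :
  P [::] -> (forall z u, P u -> P (Gen z :: u)) ->
  (forall v u, P v -> P u -> P (Br v :: u)) -> forall u, P u.
Proof.
move=> P0 Pg Pb.
pose fix L (a : letter Z) : forall u, P u -> P (a :: u) :=
  match a with
  | Gen z => Pg z
  | Br v => fun u => Pb v u ((fix W (v : word Z) : P v :=
      match v with [::] => P0 | b :: v' => L b v' (W v') end) v)
  end.
by elim=> [//|a u]; apply: L.
Qed.

(** A bracket is coded by the breadth of its content, which determines where the content ends. *)
Fixpoint lcode (a : letter Z) : seq (nat + Z) :=
  match a with
  | Gen z => [:: inr z]
  | Br u => inl (size u) :: flatten (map lcode u)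
  end.

Definition body u : seq (nat + Z) := flatten (map lcode u).

(* A prefix code whose length is one plus the degree, so that the shortlex     *)
(* order on codes compares the degree, then the breadth, then the letters.     *)
Definition wcode u : seq (nat + Z) := inl (size u) :: body u.

Lemma body_cat u v : body (u ++ v) = body u ++ body v.
Proof. by rewrite /body map_cat flatten_cat. Qed.

(** The tails [s] and [t] serve the induction: the content of a bracket is followed by the rest of
    the word. *)
Lemma body_inj u v s t :
  size u = size v -> body u ++ s = body v ++ t -> u = v /\ s = t.
Proof.
elim/word_ind: u v s t => [|z u IH|u' u IH' IH] [|[z'|v'] v] s t //=.
- by case=> szuv [-> /(IH v s t szuv)[-> ->]].
- case=> szuv [szuv']; rewrite -!/(body _) -!catA.
  by case/IH' => // -> /(IH v s t szuv)[-> ->].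
Qed.

Lemma wcode_inj : injective wcode.
Proof.
move=> u v [szuv] /(congr1 (cat^~ [::])) /body_inj.
by case/(_ szuv).
Qed.

End WordCode.

(** * Words with one star as inductive contexts *)

Section Contexts.
Variable Z : Type.
Implicit Types (u v w x y L R : word Z).

Inductive context : Type :=
  | Hole
  | Mul L (C : context) R
  | Under (C : context).

Fixpoint fill (C : context) x : word Z :=
  match C with
  | Hole => x
  | Mul L C R => L ++ fill C x ++ R
  | Under C => br (fill C x)
  end.

Lemma fill_inj C : injective (fill C).
Proof.
elim: C => [//|L C IH R|C IH] x y /=; last by case=> /IH.
move=> /eqP; rewrite eqseq_cat // eqxx /= => /eqP E.
apply: IH; have /eqP := E; rewrite eqseq_cat; first by case/andP => /eqP.
by have := congr1 size E; rewrite !size_cat => /addIn.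
Qed.

Definition starsub x (o : option Z) : word Z := if o is Some z then gen z else x.

Definition lift u : word (option Z) := wbind (fun z => gen (Some z)) u.

Lemma wbind_cat (Y Y' : Type) (f : Y -> word Y') (u v : word Y) :
  wbind f (u ++ v) = wbind f u ++ wbind f v.
Proof. by rewrite /wbind map_cat flatten_cat. Qed.

Lemma stars_cat (u v : word (option Z)) : stars (u ++ v) = (stars u + stars v)%N.
Proof. by rewrite /stars map_cat sumn_cat. Qed.

Lemma stars_lift u : stars (lift u) = 0%N.
Proof.
elim/word_ind: u => [//|z u //|v u IHv IHu].
by rewrite -[LHS]/(stars (lift v) + stars (lift u))%N IHv IHu.
Qed.

Lemma starsub_lift x u : wbind (starsub x) (lift u) = u.
Proof.
elim/word_ind: u => [//|z u IH|v u IHv IHu].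
  by rewrite -[LHS]/(Gen z :: wbind (starsub x) (lift u)) IH.
by rewrite -[LHS]/(Br (wbind (starsub x) (lift v)) :: wbind (starsub x) (lift u))
   IHv IHu.
Qed.

Lemma plug_fill C : exists q : starword Z, plug q =1 fill C.
Proof.
suff [q q1 qC] : exists2 q : word (option Z), stars q == 1%N &
    forall x, wbind (starsub x) q = fill C x.
  by exists (exist _ q q1).
elim: C => [|L C [q /eqP q1 qC] R|C [q q1 qC]].
- by exists [:: Gen None] => // x; rewrite /wbind /= cats0.
- exists (lift L ++ q ++ lift R); first by rewrite !stars_cat !stars_lift q1.
  by move=> x; rewrite !wbind_cat !starsub_lift qC.
- exists [:: Br q]; first by rewrite /stars /= addn0.
  by move=> x; rewrite /= -qC.
Qed.

Lemma starsub_const (q : word (option Z)) :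
  stars q = 0%N -> exists u, forall x, wbind (starsub x) q = u.
Proof.
elim/word_ind: q => [|[z|] q IH|p q IHp IHq].
- by exists [::].
- by case/IH=> u uE; exists (Gen z :: u) => x; rewrite -(uE x).
- by [].
- move=> /eqP; rewrite -[stars _]/(stars p + stars q)%N addn_eq0.
  case/andP=> /eqP/IHp[v vE] /eqP/IHq[u uE]; exists (Br v :: u) => x.
  by rewrite -(vE x) -(uE x).
Qed.

(** The star is either a top-level letter or inside a top-level bracket; the analysis of inclusions
    rests on this dichotomy. *)
Lemma fill_plug (q : starword Z) : exists L R,
  plug q =1 fill (Mul L Hole R) \/ exists C, plug q =1 fill (Mul L (Under C) R).
Proof.
case: q => q q1; rewrite /plug /=; move/eqP: q1.
change (stars q = 1%N -> exists L R,
  (fun x => wbind (starsub x) q) =1 fill (Mul L Hole R) \/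
  exists C, (fun x => wbind (starsub x) q) =1 fill (Mul L (Under C) R)).
elim/word_ind: q => [//|[z|] q IH|p q IHp IHq].
- case/IH => L [R LR]; exists (Gen z :: L), R.
  by case: LR => [E|[C E]]; [left | right; exists C] => x;
    exact (congr1 (cons (Gen z)) (E x)).
- by case=> /starsub_const[R E]; exists [::], R; left => x; rewrite -(E x).
- rewrite -[stars _]/(stars p + stars q)%N; case: (posnP (stars p)).
    move=> p0; rewrite p0 => /IHq [L [R LR]].
    have [u uE] := starsub_const p0; exists (Br u :: L), R.
    by case: LR => [E|[C E]]; [left | right; exists C] => x; rewrite -(uE x);
      exact (congr1 (cons _) (E x)).
  case sp: (stars p) => [//|[|//]] _ [/starsub_const[R RE]].
  have [L [R' LR]] := IHp sp; exists [::], R; right.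
  case: LR => [E|[C E]]; [exists (Mul L Hole R') | exists (Mul L (Under C) R')] => x;
    by rewrite -(RE x); exact (congr1 (fun v => Br v :: _) (E x)).
Qed.

End Contexts.

Arguments Hole {Z}.

(** * The monomial order *)

Section WordOrder.
Variables (Z : Type) (R : rel (nat + Z)).
Hypothesis Rwo : wochoice.well_order R.
Hypothesis R_inl : forall m n, R (inl m) (inl n) = (m <= n)%N.
Implicit Types (u v w x y : word Z).

Definition wordle : rel (word Z) := relpre (@wcode Z) (shortlex R).

Lemma wordle_well_order : wochoice.well_order wordle.
Proof.
exact (well_order_relpre (shortlex_well_order Rwo) (@wcode_inj Z)).
Qed.

(** Multiplication shifts degree and breadth by constants and surrounds the body by fixed codes,
    which is harmless since bodies are compared only at equal length. The code of [x] is [inl 1]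
    followed by the code of x. *)
Lemma wordle_fill C x y : wordle x y -> wordle (fill C x) (fill C y).
Proof.
elim: C x y => [//|u C IH v|C IH] x y /IH /=;
    move: (fill C x) (fill C y) => {IH} {}x {}y.
  rewrite /wordle /= /shortlex /wcode /= !body_cat !size_cat.
  rewrite !eqSS !ltnS !eqn_add2l !eqn_add2r !ltn_add2l !ltn_add2r.
  case/orP=> [->//|/andP[/[dup]/eqP szb -> /andP[le_xy imp]]].
  rewrite !R_inl in le_xy imp *; rewrite !leq_add2l !leq_add2r le_xy /=.
  apply/orP; right; apply/implyP => le_yx.
  by rewrite lexle_catl // lexle_catr // (implyP imp).
rewrite /wordle /= /shortlex /wcode /= !R_inl leqnn /= !cats0.
by rewrite !ltnS !eqSS.
Qed.

Lemma wlt_fill C x y : wlt wordle x y -> wlt wordle (fill C x) (fill C y).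
Proof.
case/andP=> neq le_xy; apply/andP; split; last exact: wordle_fill.
by apply: contra neq => /eqP/fill_inj ->.
Qed.

Lemma wordle_monomial_order : monomial_order wordle.
Proof.
split=> [|u v q]; first exact: wordle_well_order.
have [L [r [qE|[C qE]]]] := fill_plug q; rewrite !qE; exact: wlt_fill.
Qed.

Lemma wlt_size_body x y : (size (body x) < size (body y))%N -> wlt wordle x y.
Proof.
move=> xy; apply/andP; split; first by apply: contraTneq xy => ->; rewrite ltnn.
by rewrite /wordle /= /shortlex /= ltnS xy.
Qed.

Lemma wlt_breadth x y : size (body x) = size (body y) ->
  (size x < size y)%N -> wlt wordle x y.
Proof.
move=> sz xy; apply/andP; split; first by apply: contraTneq xy => ->; rewrite ltnn.
rewrite /wordle /= /shortlex /= eqSS sz eqxx !R_inl (ltnW xy).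
by rewrite (leqNgt (size y)) xy /= orbT.
Qed.

End WordOrder.

(** * Linear extension of maps on words *)

Section Linext.
Variables (k : fieldType) (Y Z : Type).
Implicit Types (f : word Y -> word Z) (p : {malg k[word Y]}).

Lemma linextEw f p (d : {fset word Y}) : (msupp p `<=` d)%fset ->
  linext f p = \sum_(w <- d) p@_w *: << f w >>.
Proof.
move=> le; rewrite /linext (big_fset_incl _ le) // => w _ /mcoeff_outdom ->.
by rewrite scale0r.
Qed.

Lemma linext_is_linear f : linear (linext (k := k) f).
Proof.
move=> a p q; set d := (msupp p `|` msupp q)%fset.
have pd : (msupp p `<=` d)%fset by apply: fsubsetUl.
have qd : (msupp q `<=` d)%fset by apply: fsubsetUr.
rewrite (linextEw f pd) (linextEw f qd) (@linextEw f _ d); last first.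
  by apply: fsubset_trans (msuppD_le _ _) _; apply: fsetUSS => //;
     apply: fsubset_trans (msuppZ_le _ _) _.
rewrite scaler_sumr -big_split /=; apply: eq_bigr => w _.
by rewrite mcoeffD mcoeffZ scalerDl scalerA.
Qed.

HB.instance Definition _ f :=
  GRing.isLinear.Build k {malg k[word Y]} {malg k[word Z]} *:%R (linext f)
    (linext_is_linear f).

Lemma linextU f w : linext f (<< w >> : {malg k[word Y]}) = << f w >>.
Proof. by rewrite /linext msuppU1 big_seq_fset1 mcoeffUU scale1r. Qed.

Lemma eq_linext f g : f =1 g -> @linext k Y Z f =1 linext g.
Proof. by move=> fg p; apply: eq_bigr => w _; rewrite fg. Qed.

End Linext.

Lemma mulUU (k : fieldType) (Z : Type) (u v : word Z) :
  << u >> * << v >> = << u ++ v >> :> {malg k[word Z]}.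
Proof. by rewrite malgM_def fgmulUU mulr1. Qed.

Lemma mulU_scaleU (k : fieldType) (Z : Type) (c : k) (u v : word Z) :
  << u >> * (c *: << v >>) = c *: << u ++ v >> :> {malg k[word Z]}.
Proof.
have scaleU (w : word Z) : c *: << w >> = << c *g w >> :> {malg k[word Z]}.
  by apply/malgP => t; rewrite mcoeffZ !mcoeffU mulrnAr mulr1.
by rewrite !scaleU malgM_def fgmulUU mul1r.
Qed.

(** * Trivial elements and leading monomials *)

Section Trivial.
Variables (k : fieldType) (Z : Type) (le : rel (word Z)).
Variables (S : set {malg k[word Z]}) (w : word Z).

Lemma trivial_mod0 : trivial_mod le S w 0.
Proof.
have F (i : 'I_0) : False by case: i.
by exists 0%N, (fun=> 0), (fun i => False_rect _ (F i)), (fun=> 0); split => [[]//|];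
  rewrite big_ord0.
Qed.

Lemma trivial_mod_plug (q : starword Z) (s : {malg k[word Z]}) :
  S s -> wlt le (plug q (lead le s)) w -> trivial_mod le S w (mplug q s).
Proof.
move=> Ss qw; exists 1%N, (fun=> 1), (fun=> q), (fun=> s); split=> //.
by rewrite big_ord1 scale1r.
Qed.

Lemma trivial_modZ (c : k) h : trivial_mod le S w h -> trivial_mod le S w (c *: h).
Proof.
move=> [n [a [q [s [sS ->]]]]]; exists n, (fun i => c * a i), q, s; split=> //.
by rewrite scaler_sumr; apply: eq_bigr => i _; rewrite scalerA.
Qed.

Lemma trivial_modD h1 h2 :
  trivial_mod le S w h1 -> trivial_mod le S w h2 -> trivial_mod le S w (h1 + h2).
Proof.
move=> [m [a [q [s [sS ->]]]]] [n [b [r [t [tS ->]]]]].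
pose join T (f : 'I_m -> T) (g : 'I_n -> T) (i : 'I_(m + n)) :=
  match fintype.split i with inl j => f j | inr j => g j end.
exists (m + n)%N, (join _ a b), (join _ q r), (join _ s t); split.
  by move=> i; rewrite /join; case: fintype.split.
have joinl T f g i : join T f g (lshift n i) = f i.
  by rewrite /join -[lshift n i]/(fintype.unsplit (inl i)) unsplitK.
have joinr T f g i : join T f g (rshift m i) = g i.
  by rewrite /join -[rshift m i]/(fintype.unsplit (inr i)) unsplitK.
clearbody join; rewrite [RHS]big_split_ord.
apply: congr2.
  by apply: eq_bigr => i _; rewrite !joinl.
by apply: eq_bigr => i _; rewrite !joinr.
Qed.

Lemma trivial_modN h : trivial_mod le S w h -> trivial_mod le S w (- h).
Proof. by rewrite -scaleN1r; apply: trivial_modZ. Qed.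

Lemma trivial_modB h1 h2 :
  trivial_mod le S w h1 -> trivial_mod le S w h2 -> trivial_mod le S w (h1 - h2).
Proof. by move=> t1 t2; apply/trivial_modD/trivial_modN. Qed.

End Trivial.

Lemma lead_max (k : fieldType) (Z : Type) (le : rel (word Z)) p w :
  wochoice.well_order le -> p@_w != 0 :> k -> (forall v, p@_v != 0 -> le v w) ->
  lead le p = w.
Proof.
move=> wo pw pmax; rewrite /lead; set s := sort le _.
have ms v : (v \in s) = (p@_v != 0) by rewrite mem_sort mcoeff_neq0.
have srt : sorted le s by apply: sort_sorted; apply: well_order_total.
have : w \in s by rewrite ms.
have : forall v, v \in s -> le v w by move=> v; rewrite ms; apply: pmax.
clearbody s; case/lastP: s srt {ms} => [//|s v] srt smax.
rewrite last_rcons mem_rcons inE => /predU1P[-> //|ws].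
apply: (well_order_anti wo); rewrite smax ?mem_rcons ?mem_head //=.
move: srt; rewrite (sorted_pairwise (well_order_trans wo)) pairwise_rcons.
by case/andP => /allP/(_ w ws).
Qed.

(* phi(u,v) plugged into F.  It is locked because otherwise rewriting compares *)
(* such polynomials by unfolding the operations of the monoid algebra.         *)
HB.lock Definition mrb (k : fieldType) (lambda : k) (Z : Type)
    (F : word Z -> word Z) (u v : word Z) : {malg k[word Z]} :=
  << F (br u ++ br v) >> - << F (br (u ++ br v)) >> - << F (br (br u ++ v)) >>
    - lambda *: << F (u ++ v) >>.

(** * Instances of phi and their compositions *)

Section ModifiedRotaBaxter.
Variables (k : fieldType) (lambda : k).

Lemma opsubst_mrb (Z : Type) (u : 'I_2 -> word Z) :
  opsubst (modified_Rota_Baxter lambda) u = mrb lambda id (u ord0) (u ord_max).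
Proof.
rewrite /opsubst /modified_Rota_Baxter /bracket !(linextU, mulUU).
rewrite !linearB /= linearZ /= !linextU mrb.unlock /br /gen /wbind /=.
by rewrite !cats0.
Qed.

Variables (Z : Type) (R : rel (nat + Z)).
Hypothesis Rwo : wochoice.well_order R.
Hypothesis R_inl : forall m n, R (inl m) (inl n) = (m <= n)%N.
Implicit Types (u v w x y : word Z).

Notation le := (wordle R).
Notation lt := (wlt (wordle R)).
Notation S := (monic_set le (opi_set (modified_Rota_Baxter lambda) (Z := Z))).

Notation mrb := (mrb lambda).

Lemma linext_mrb (F G : word Z -> word Z) u v :
  linext F (mrb G u v) = mrb (F \o G) u v.
Proof. by rewrite mrb.unlock !linearB /= linearZ /= !linextU. Qed.

Lemma mul_mrb_r F u v w : mrb F u v * << w >> = mrb (fun x => F x ++ w) u v.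
Proof. by rewrite mrb.unlock !mulrBl -scalerAl !mulUU. Qed.

Lemma mul_mrb_l F u v w : << w >> * mrb F u v = mrb (fun x => w ++ F x) u v.
Proof. by rewrite mrb.unlock !mulrBr mulU_scaleU !mulUU. Qed.

Lemma mcoeff_mrb F u v t : (mrb F u v)@_t =
  (F (br u ++ br v) == t)%:R - (F (br (u ++ br v)) == t)%:R
    - (F (br (br u ++ v)) == t)%:R - lambda * (F (u ++ v) == t)%:R.
Proof. by rewrite mrb.unlock !mcoeffB mcoeffZ !mcoeffU. Qed.

Let size_body_br u : size (body (br u)) = (size (body u)).+1.
Proof. by rewrite /body /= cats0. Qed.

Let size_body_Br u v : size (body (Br u :: v)) = (size (body u) + size (body v)).+1.
Proof. by rewrite /body /= size_cat. Qed.

Let size_body_cat u v : size (body (u ++ v)) = (size (body u) + size (body v))%N.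
Proof. by rewrite body_cat size_cat. Qed.

Let size_body_nil : size (@body Z [::]) = 0%N. Proof. by []. Qed.

Let size_bodyE := (size_body_cat, size_body_br, size_body_Br, size_body_nil).

Lemma lt_mrb1 u v : lt (br (u ++ br v)) (br u ++ br v).
Proof.
apply: wlt_breadth => //.
by rewrite !size_bodyE addSn.
Qed.

Lemma lt_mrb2 u v : lt (br (br u ++ v)) (br u ++ br v).
Proof.
apply: wlt_breadth => //.
by rewrite !size_bodyE addnS.
Qed.

Lemma lt_mrb3 u v : lt (u ++ v) (br u ++ br v).
Proof.
apply: wlt_size_body.
by rewrite !size_bodyE addnS addSn ltnS leqW.
Qed.

Lemma coef_mrb u v : (mrb id u v)@_(br u ++ br v) = 1.
Proof.
rewrite mcoeff_mrb /= eqxx.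
case/andP: (lt_mrb1 u v) => /negbTE -> _; case/andP: (lt_mrb2 u v) => /negbTE -> _.
by case/andP: (lt_mrb3 u v) => /negbTE -> _; rewrite mulr0 !subr0.
Qed.

Lemma lead_mrb u v : lead le (mrb id u v) = br u ++ br v.
Proof.
apply: lead_max; first exact: wordle_well_order.
  by rewrite coef_mrb oner_neq0.
move=> w; rewrite mcoeff_mrb /=.
have [<- _|_] := eqVneq _ w; first exact: (well_order_refl (wordle_well_order Rwo)).
have [<- _|_] := eqVneq _ w; first by case/andP: (lt_mrb1 u v).
have [<- _|_] := eqVneq _ w; first by case/andP: (lt_mrb2 u v).
have [<- _|_] := eqVneq _ w; first by case/andP: (lt_mrb3 u v).
by rewrite mulr0 !subr0 eqxx.
Qed.

(** Every instance is nonzero with leading coefficient 1, so [make_monic] fixes it. *)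
Lemma monic_mrbP f : S f <-> exists u v, f = mrb id u v.
Proof.
have monic u v : make_monic le (mrb id u v) = mrb id u v.
  by rewrite /make_monic lead_mrb coef_mrb invr1 scale1r.
split=> [[_ [[u _ <-] _] <-]|[u [v ->]]].
  by exists (u ord0), (u ord_max); rewrite opsubst_mrb monic.
exists (mrb id u v); last exact: monic.
split; last by apply: contraTneq (oner_neq0 k) => E;
  rewrite -(coef_mrb u v) E mcoeff0 eqxx.
by exists (fun i : 'I_2 => if i == ord0 then u else v); rewrite // opsubst_mrb.
Qed.

Lemma trivial_mrb C u v w : lt (fill C (br u ++ br v)) w ->
  trivial_mod le S w (mrb (fill C) u v).
Proof.
move=> ltw; have [q qC] := plug_fill C.
rewrite -[fill C]/(fill C \o id) -linext_mrb -(eq_linext qC).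
apply: trivial_mod_plug; last by rewrite lead_mrb qC.
by apply/monic_mrbP; exists u, v.
Qed.

(** Four instances remove the products of two brackets; the remaining [[u][v]w] and [u[v][w]] are
    removed by phi(u,v) and phi(v,w) inside a bracket. The lambda-terms in uv[w] and [u]vw match
    those of the composition, and those in u[v]w and [uvw] cancel in pairs. *)
Lemma trivial_intersection u v w :
  trivial_mod le S (br u ++ br v ++ br w)
    (mrb id u v * << br w >> - << br u >> * mrb id v w).
Proof.
have -> : mrb id u v * << br w >> - << br u >> * mrb id v w =
  mrb (fill Hole) u (v ++ br w) + mrb (fill Hole) u (br v ++ w)
  - mrb (fill Hole) (u ++ br v) w - mrb (fill Hole) (br u ++ v) w
  + mrb (fill (Under (Mul [::] Hole w))) u v
  - mrb (fill (Under (Mul u Hole [::]))) v w.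
  rewrite mul_mrb_r mul_mrb_l.
  (* Comparing coefficients at [t] leaves a commutative ring identity in the indicators of the
     monomials. *)
  apply/malgP => t.
  rewrite !(mcoeffB, mcoeffD, mcoeffN).
  rewrite !mcoeff_mrb /= -!catA !cats0.
  ring.
(* The six leading monomials have the degree of [u][v][w] but breadth at most 2. *)
have lt_breadth x : size (body x) = size (body (br u ++ br v ++ br w)) ->
  (size x < 3)%N -> lt x (br u ++ br v ++ br w) by apply: wlt_breadth.
by repeat first [apply: trivial_modB | apply: trivial_modD]; apply: trivial_mrb;
  rewrite /= ?cats0; apply: lt_breadth => //;
  rewrite !size_bodyE; lia.
Qed.

(** Expand phi(F(phi(u,v)),x) along the inner or the outer phi and equate. The instances phi(F(m),x)
    lie below [w] by monotonicity; the other leading monomials are the lower monomials of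
    phi(F([u][v]),x). *)
Lemma trivial_including_l C u v x :
  trivial_mod le S (br (fill C (br u ++ br v)) ++ br x)
   (mrb id (fill C (br u ++ br v)) x - mrb (fill (Mul [::] (Under C) (br x))) u v).
Proof.
set F := fill C; set w := br _ ++ br x.
have -> : mrb id (F (br u ++ br v)) x - mrb (fill (Mul [::] (Under C) (br x))) u v =
  mrb (fill Hole) (F (br (u ++ br v))) x + mrb (fill Hole) (F (br (br u ++ v))) x
  + lambda *: mrb (fill Hole) (F (u ++ v)) x
  - mrb (fill (Under (Mul [::] C (br x)))) u v
  - mrb (fill (Under (Mul [::] (Under C) x))) u v
  - lambda *: mrb (fill (Mul [::] C x)) u v.
  apply/malgP => t; rewrite !(mcoeffB, mcoeffD, mcoeffN, mcoeffZ).
  rewrite !mcoeff_mrb /= -/F; ring.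
have Hlt y : lt y (br u ++ br v) -> lt (fill Hole (br (F y) ++ br x)) w.
  exact: (wlt_fill Rwo R_inl (Mul [::] (Under C) (br x))).
apply: trivial_modB; last exact/trivial_modZ/trivial_mrb/lt_mrb3.
apply: trivial_modB; last exact/trivial_mrb/lt_mrb2.
apply: trivial_modB; last exact/trivial_mrb/lt_mrb1.
apply: trivial_modD; last exact/trivial_modZ/trivial_mrb/Hlt/lt_mrb3.
apply: trivial_modD; first exact/trivial_mrb/Hlt/lt_mrb1.
exact/trivial_mrb/Hlt/lt_mrb2.
Qed.

Lemma trivial_including_r C u v x :
  trivial_mod le S (br x ++ br (fill C (br u ++ br v)))
   (mrb id x (fill C (br u ++ br v)) - mrb (fill (Mul (br x) (Under C) [::])) u v).
Proof.
set F := fill C; set w := br x ++ br _.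
have -> : mrb id x (F (br u ++ br v)) - mrb (fill (Mul (br x) (Under C) [::])) u v =
  mrb (fill Hole) x (F (br (u ++ br v))) + mrb (fill Hole) x (F (br (br u ++ v)))
  + lambda *: mrb (fill Hole) x (F (u ++ v))
  - mrb (fill (Under (Mul x (Under C) [::]))) u v
  - mrb (fill (Under (Mul (br x) C [::]))) u v
  - lambda *: mrb (fill (Mul x C [::])) u v.
  apply/malgP => t; rewrite !(mcoeffB, mcoeffD, mcoeffN, mcoeffZ).
  rewrite !mcoeff_mrb /= !cats0 -/F; ring.
have Hlt y : lt y (br u ++ br v) -> lt (fill Hole (br x ++ br (F y))) w.
  exact: (wlt_fill Rwo R_inl (Mul (br x) (Under C) [::])).
apply: trivial_modB; last by
  apply/trivial_modZ/trivial_mrb; rewrite /= cats0; apply/lt_mrb3.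
apply: trivial_modB; last by
  apply/trivial_mrb; rewrite /= cats0; apply/lt_mrb2.
apply: trivial_modB; last exact/trivial_mrb/lt_mrb1.
apply: trivial_modD; last exact/trivial_modZ/trivial_mrb/Hlt/lt_mrb3.
apply: trivial_modD; first exact/trivial_mrb/Hlt/lt_mrb1.
exact/trivial_mrb/Hlt/lt_mrb2.
Qed.

Lemma mrb_GS_basis : GS_basis le (opi_set (modified_Rota_Baxter lambda) (Z := Z)).
Proof.
move=> f g w h /monic_mrbP[a [b ->]] /monic_mrbP[c [d ->]] [].
  case=> u [v [-> wE lo hi ->]]; move: wE lo hi; rewrite !lead_mrb /breadth.
  (* The breadth of [w] is strictly between 2 and 4, so [u] and [v] are single letters. *)
  case: u => [|u1 [|u2 u]] //=; case: v => [|v1 [|v2 v]] //=.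
    by case=> <- <- -> _ _; apply: trivial_intersection.
  by move/(congr1 size); rewrite /= size_cat /= !addnS.
case=> q [-> wE ->]; move: wE; rewrite !lead_mrb /mplug.
have [L [r [qE|[C qE]]]] := fill_plug q; rewrite (eq_linext qE) qE linext_mrb.
  (* Star at top level: both leading monomials have breadth 2, so they coincide and the composition
     is 0. *)
  case: L qE => [|l1 [|l2 L]] /= qE.
  - case=> -> ->; case: r qE => // qE _.
    have -> : fill (Mul [::] Hole [::]) \o id = id :> (word Z -> word Z).
      by rewrite funeqE => x; apply: cats0.
    by rewrite subrr; apply: trivial_mod0.
  - by case.
  - by move/(congr1 size); rewrite /= size_cat /= !addnS.
(* Star inside a bracket, which must be the first or the second letter of [a][b]. *)
case: L qE => [|l1 [|l2 L]] /= qE.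
- case=> -> <-; exact: trivial_including_l.
- case=> <- ->; case: r qE => // qE _; exact: trivial_including_r.
- by move/(congr1 size); rewrite /= size_cat /= !addnS.
Qed.

End ModifiedRotaBaxter.

Theorem theorem4p6 (k : fieldType) (lambda : k) :
  GS_opi (modified_Rota_Baxter lambda).
Proof.
move=> Z; have [RZ RZwo] := wochoice.well_ordering_principle {classic Z}.
(* Breadths keep their usual order, as [R_inl] demands, and are placed below the generators, which
   are well-ordered by choice. *)
pose R (a b : nat + Z) := match a, b with
  | inl m, inl n => (m <= n)%N | inl _, inr _ => true
  | inr _, inl _ => false | inr x, inr y => RZ x y end.
have Rwo : wochoice.well_order R by apply: well_order_sum.
exists (wordle R); split; first exact: wordle_monomial_order.
exact: mrb_GS_basis.
Qed.
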